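(* Let $n \ge 1$ be an integer, let $e \in C(\mathbb{R})$ satisfy $e(t+2\pi)=e(t)$ for all $t$, and let $f,g \in C(\mathbb{R})$. Put $F(x)=\int_0^x f(z)\,dz$. Assume that the finite limits $F(\pm\infty)=\lim_{x\to\pm\infty}F(x)$ and $g(\pm\infty)=\lim_{x\to\pm\infty}g(x)$ exist, and that for all $x\in\mathbb{R}$ $$F(-\infty)<F(x)<F(\infty), \qquad g(-\infty)<g(x)<g(\infty).$$ Let $A_n=\int_0^{2\pi}e(t)\cos nt\,dt$ and $B_n=\int_0^{2\pi}e(t)\sin nt\,dt$. If the equation $$x''+f(x)x'+g(x)+n^2x=e(t)$$ has a $2\pi$-periodic solution $x=x(t)$, then $$\sqrt{A_n^2+B_n^2}<2n\left(F(\infty)-F(-\infty)\right)+2\left(g(\infty)-g(-\infty)\right).$$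
   Context: Solutions are classical: $x$ is a $C^2$ real-valued function of $t\in\mathbb{R}$. *)

(* Defs.v *)
From Stdlib Require Import Reals.
From Coquelicot Require Import Coquelicot.
Open Scope R_scope.

Definition periodic (T : R) (u : R -> R) : Prop :=
  forall t : R, u (t + T) = u t.

Definition int_from0 (f : R -> R) (x : R) : R := RInt f 0 x.

(* Unnormalized: no factor [1 / PI]. *)
Definition fourier_cos (e : R -> R) (n : nat) : R :=
  RInt (fun t => e t * cos (INR n * t)) 0 (2 * PI).

Definition fourier_sin (e : R -> R) (n : nat) : R :=
  RInt (fun t => e t * sin (INR n * t)) 0 (2 * PI).

(* [Derive_n] is total, so differentiability has to be required separately. *)
Definition is_C2 (x : R -> R) : Prop :=
  (forall t : R, ex_derive_n x 1 t) /\
  (forall t : R, ex_derive_n x 2 t) /\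
  (forall t : R, continuous (Derive_n x 2) t).

Definition is_solution (n : nat) (e f g x : R -> R) : Prop :=
  is_C2 x /\
  forall t : R,
    Derive_n x 2 t + f (x t) * Derive x t + g (x t) + INR n ^ 2 * x t = e t.

(* Main.v *)
(** Multiplying the equation by [cos (n t - p)] and integrating by parts over a
    period kills [x'' + n^2 x], so the integral of [e cos (n t - p)] equals that of
    [g(x) cos (n t - p) + n F(x) sin (n t - p)]. Both trigonometric factors have
    mean zero, so [g(x)] and [F(x)] may be recentred at the midpoints of their
    ranges; as the integral of [|sin (n t - p)|] over a period is 4, this gives the
    bound. It is strict because [x] has compact range. Choosing [p] as the argument
    of [A_n + i B_n] finishes the proof. *)
Require Import Defs.
From Stdlib Require Import Reals Lra Lia.
From Coquelicot Require Import Coquelicot.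
Open Scope R_scope.

(** * Preliminaries: integrals over periods, compactness, polar angles *)

Lemma RInt_periodic (T : R) (h : R -> R) (a : R) :
  (forall t, continuous h t) -> periodic T h ->
  RInt h a (a + T) = RInt h 0 T.
Proof.
  intros hc hp.
  assert (hi : forall u v, ex_RInt h u v)
    by (intros u v; apply (@ex_RInt_continuous R_CompleteNormedModule); intros; apply hc).
  (* Translation by the period carries the piece from [T] to [a + T] back to the one from [0] to
     [a], which cancels the piece from [a] to [0] in the splitting below. *)
  assert (shift : RInt h T (a + T) = RInt h 0 a).
  { replace T with (1 * 0 + T) at 1 by ring.
    replace (a + T) with (1 * a + T) by ring.
    rewrite <- (RInt_comp_lin h 1 T 0 a) by apply hi.
    apply RInt_ext; intros t _.
    unfold scal; simpl; unfold mult; simpl.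
    rewrite !Rmult_1_l; apply hp. }
  rewrite <- (RInt_Chasles h a 0 (a + T)) by apply hi.
  rewrite <- (RInt_Chasles h 0 T (a + T)) by apply hi.
  rewrite shift, <- (opp_RInt_swap h a 0) by apply hi.
  unfold plus, opp; simpl; ring.
Qed.

Lemma RInt_periodic_mult (T : R) (h : R -> R) (a : R) (k : nat) :
  (forall t, continuous h t) -> periodic T h ->
  RInt h a (a + INR k * T) = INR k * RInt h 0 T.
Proof.
  intros hc hp.
  assert (hi : forall u v, ex_RInt h u v)
    by (intros u v; apply (@ex_RInt_continuous R_CompleteNormedModule); intros; apply hc).
  induction k as [|k IH].
  - simpl; replace (a + 0 * T) with a by ring.
    rewrite RInt_point; unfold zero; simpl; ring.
  - rewrite <- (RInt_Chasles h a (a + INR k * T)) by apply hi.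
    rewrite IH, S_INR.
    replace (a + (INR k + 1) * T) with ((a + INR k * T) + T) by ring.
    rewrite RInt_periodic by assumption.
    unfold plus; simpl; ring.
Qed.

Lemma continuous_abs_sin (t : R) : continuous (fun u => Rabs (sin u)) t.
Proof.
  apply (continuous_comp sin Rabs); [apply continuous_sin | apply continuous_Rabs].
Qed.

Lemma RInt_abs_sin_0_PI : RInt (fun u => Rabs (sin u)) 0 PI = 2.
Proof.
  pose proof PI_RGT_0.
  rewrite (RInt_ext _ sin).
  - apply is_RInt_unique.
    replace 2 with (minus (- cos PI) (- cos 0))
      by (rewrite cos_PI, cos_0; unfold minus, plus, opp; simpl; ring).
    apply (is_RInt_derive (fun u => - cos u)).
    + intros u _; auto_derive; [exact I | ring].
    + intros u _; apply continuous_sin.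
  - intros u hu; rewrite Rmin_left, Rmax_right in hu by lra.
    apply Rabs_pos_eq, sin_ge_0; lra.
Qed.

(** Substituting [u = n t - p] sweeps [2 n] periods of [|sin|], each of length [PI] and integral 2;
    the Jacobian [1 / n] then leaves 4, whatever [n] and [p] are. *)
Lemma is_RInt_abs_sin_affine (n : nat) (p : R) : (1 <= n)%nat ->
  is_RInt (fun t => Rabs (sin (INR n * t - p))) 0 (2 * PI) 4.
Proof.
  intros hn.
  assert (hn0 : 0 < INR n) by (apply lt_0_INR; lia).
  assert (hc : forall t, continuous (fun u => Rabs (sin (INR n * u - p))) t).
  { intros t; apply (continuous_comp (fun u => INR n * u - p) (fun u => Rabs (sin u))).
    - apply (@ex_derive_continuous R_AbsRing R_NormedModule); auto_derive; exact I.
    - apply continuous_abs_sin. }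
  replace 4 with (RInt (fun t => Rabs (sin (INR n * t - p))) 0 (2 * PI)).
  { apply (@RInt_correct R_CompleteNormedModule), (@ex_RInt_continuous R_CompleteNormedModule).
    intros; apply hc. }
  (* The factor [n] supplies the Jacobian that the linear substitution expects. *)
  apply Rmult_eq_reg_l with (INR n); [|lra].
  rewrite <- (RInt_scal (V := R_CompleteNormedModule) _ 0 (2 * PI) (INR n))
    by (apply (@ex_RInt_continuous R_CompleteNormedModule); intros; apply hc).
  rewrite (RInt_comp_lin (fun u => Rabs (sin u)) (INR n) (- p))
    by (apply (@ex_RInt_continuous R_CompleteNormedModule); intros; apply continuous_abs_sin).
  replace (INR n * 0 + - p) with (- p) by ring.
  replace (INR n * (2 * PI) + - p) with (- p + INR (2 * n) * PI)
    by (rewrite mult_INR; simpl; ring).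
  rewrite RInt_periodic_mult, RInt_abs_sin_0_PI, mult_INR.
  - simpl; ring.
  - apply continuous_abs_sin.
  - intros t; rewrite neg_sin; apply Rabs_Ropp.
Qed.

(** The distance to the midpoint attains its maximum over the compact interval, and at that point it
    is below the half-width. This uniform gap makes the final inequality strict. *)
Lemma bounded_strictly_inside (h : R -> R) (a b l u : R) : a <= b ->
  (forall t, continuous h t) -> (forall t, l < h t < u) ->
  exists M, M < (u - l) / 2 /\
    forall t, a <= t <= b -> Rabs (h t - (l + u) / 2) <= M.
Proof.
  intros hab hc hb.
  destruct (continuity_ab_maj (fun t => Rabs (h t - (l + u) / 2)) a b hab)
    as [m [hm _]].
  - intros t _; apply continuity_pt_filterlim.
    apply (continuous_comp (fun t => h t - (l + u) / 2) Rabs);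
      [|apply continuous_Rabs].
    apply (continuous_minus (V := R_NormedModule)); [apply hc | apply continuous_const].
  - exists (Rabs (h m - (l + u) / 2)); split.
    + apply Rabs_def1; specialize (hb m); lra.
    + exact hm.
Qed.

(** The angle is an argument of [a + i b]: [acos (a / r)], with its sign chosen according to that of
    [b]. *)
Lemma polar_form (a b : R) : exists p,
  a * cos p + b * sin p = sqrt (a ^ 2 + b ^ 2).
Proof.
  set (r := sqrt (a ^ 2 + b ^ 2)).
  assert (hrr : r * r = a ^ 2 + b ^ 2) by (apply sqrt_sqrt; nra).
  assert (hr0 : 0 <= r) by apply sqrt_pos.
  destruct (Req_dec r 0) as [hz | hnz].
  { exists 0; rewrite hz in *; rewrite cos_0, sin_0; nra. }
  assert (hr : 0 < r) by lra.
  assert (hdom : -1 <= a / r <= 1).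
  { split; [apply Rle_div_r | apply Rle_div_l]; nra. }
  (* The sine of an [acos] is nonnegative, so only [|b|] is recovered here; negating the angle
     handles [b < 0]. *)
  assert (hs : sin (acos (a / r)) = Rabs b / r).
  { rewrite sin_acos by exact hdom.
    rewrite <- (sqrt_Rsqr (Rabs b / r)).
    - f_equal.
      rewrite !Rsqr_div', <- Rsqr_abs; unfold Rsqr.
      apply Rmult_eq_reg_r with (r * r); [|nra].
      field_simplify; [nra | exact hnz | exact hnz].
    - apply Rdiv_le_0_compat; [apply Rabs_pos | exact hr]. }
  assert (hfin : a * (a / r) + b * (b / r) = r).
  { apply Rmult_eq_reg_r with r; [|exact hnz].
    field_simplify; [nra | exact hnz]. }
  destruct (Rle_dec 0 b) as [hb | hb].
  - exists (acos (a / r)); rewrite cos_acos, hs, Rabs_pos_eq by assumption; exact hfin.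
  - exists (- acos (a / r)); rewrite cos_neg, sin_neg, cos_acos, hs, Rabs_left by lra.
    transitivity (a * (a / r) + b * (b / r)); [field; exact hnz | exact hfin].
Qed.

(** * Integrating the equation against a phase-shifted cosine *)

Lemma Derive_periodic (T : R) (x : R -> R) :
  (forall t, ex_derive x t) -> periodic T x -> periodic T (Derive x).
Proof.
  intros hd hp t; symmetry.
  apply is_derive_unique, (is_derive_ext (fun u => x (u + T))); [exact hp|].
  auto_derive; [apply hd | apply Rmult_1_l].
Qed.

Lemma is_derive_int_from0 (f : R -> R) (x : R) :
  (forall z, continuous f z) -> is_derive (int_from0 f) x (f x).
Proof.
  intros hf; apply (is_derive_RInt f (int_from0 f) 0); [|apply hf].
  apply filter_forall; intros y.
  apply (@RInt_correct R_CompleteNormedModule), (@ex_RInt_continuous R_CompleteNormedModule).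
  intros; apply hf.
Qed.

Lemma fourier_rotate (e : R -> R) (n : nat) (p : R) :
  (forall t, continuous e t) ->
  is_RInt (fun t => e t * cos (INR n * t - p)) 0 (2 * PI)
    (fourier_cos e n * cos p + fourier_sin e n * sin p).
Proof.
  intros he.
  assert (hcont : forall w : R -> R, (forall t, ex_derive w t) ->
    ex_RInt (fun t => e t * w t) 0 (2 * PI)).
  { intros w hw; apply (@ex_RInt_continuous R_CompleteNormedModule); intros t _.
    apply (continuous_mult e w); [apply he|].
    apply (@ex_derive_continuous R_AbsRing R_NormedModule), hw. }
  apply (is_RInt_ext (fun t => plus (scal (cos p) (e t * cos (INR n * t)))
                                 (scal (sin p) (e t * sin (INR n * t))))).
  { intros t _; rewrite cos_minus; unfold plus, scal; simpl; unfold mult; simpl; ring. }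
  rewrite (Rmult_comm _ (cos p)), (Rmult_comm _ (sin p)).
  apply (is_RInt_plus (V := R_NormedModule)); apply (is_RInt_scal (V := R_NormedModule));
    apply (@RInt_correct R_CompleteNormedModule), hcont; intros t; auto_derive; exact I.
Qed.

(* The midpoint constants [c], [d] cost nothing: [cos] and [sin] have mean zero. *)
Lemma solution_identity (n : nat) (e f g x : R -> R) (p c d : R) :
  (1 <= n)%nat ->
  (forall t, continuous e t) -> (forall z, continuous f z) ->
  (forall z, continuous g z) -> is_solution n e f g x -> periodic (2 * PI) x ->
  is_RInt (fun t => (g (x t) - d) * cos (INR n * t - p)
                    + INR n * (int_from0 f (x t) - c) * sin (INR n * t - p))
    0 (2 * PI) (fourier_cos e n * cos p + fourier_sin e n * sin p).
Proof.
  intros hn he hf hg [[hx1 [hx2 _]] heq] hper.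
  assert (hn0 : INR n <> 0) by (apply not_0_INR; lia).
  assert (hx : forall t, ex_derive x t) by exact hx1.
  assert (hdx : forall t, ex_derive (Derive x) t) by exact hx2.
  assert (hFd : forall t, is_derive (int_from0 f) t (f t))
    by (intros t; apply is_derive_int_from0; exact hf).
  assert (hxc : forall t, continuous x t)
    by (intros t; apply (@ex_derive_continuous R_AbsRing R_NormedModule), hx).
  assert (hFx : forall t, continuous (fun s => int_from0 f (x s)) t).
  { intros t; apply (continuous_comp x (int_from0 f)); [apply hxc|].
    apply (@ex_derive_continuous R_AbsRing R_NormedModule); eexists; apply hFd. }
  assert (hgx : forall t, continuous (fun s => g (x s)) t)
    by (intros t; apply (continuous_comp x g); [apply hxc | apply hg]).
  (* [q] is [e t * cos (n t - p)] minus the integrand of the claim, so it suffices that [q] has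
     integral zero. *)
  set (q := fun t => (e t - (g (x t) - d)) * cos (INR n * t - p)
                     - INR n * (int_from0 f (x t) - c) * sin (INR n * t - p)).
  assert (htr : forall t, continuous (fun s => cos (INR n * s - p)) t
                       /\ continuous (fun s => sin (INR n * s - p)) t).
  { intros t; split; apply (@ex_derive_continuous R_AbsRing R_NormedModule);
      auto_derive; exact I. }
  assert (hq : is_RInt q 0 (2 * PI) 0).
  (* All integrations by parts at once: along the solution [P' = q]. The first two terms of [P]
     yield [(x'' + n^2 x) cos], the third yields [f(x) x' cos - n (F(x) - c) sin], and the last
     yields [d cos]. *)
  { set (P := fun t => Derive x t * cos (INR n * t - p)
                + INR n * x t * sin (INR n * t - p)
                + (int_from0 f (x t) - c) * cos (INR n * t - p)
                + d / INR n * sin (INR n * t - p)).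
    (* [x] and [x'] return to their initial values, and the phase advances by [2 n PI], a whole
       number of turns. *)
    assert (hP : minus (P (2 * PI)) (P 0) = 0).
    { assert (h1 : x (2 * PI) = x 0) by (rewrite <- (hper 0); f_equal; ring).
      assert (h2 : Derive x (2 * PI) = Derive x 0)
        by (rewrite <- (Derive_periodic _ _ hx hper 0); f_equal; ring).
      assert (h3 : INR n * (2 * PI) - p = INR n * 0 - p + 2 * INR n * PI) by ring.
      unfold P; rewrite h1, h2, h3, cos_period, sin_period.
      unfold minus, plus, opp; simpl; ring. }
    apply (eq_ind _ (is_RInt q 0 (2 * PI))) with (2 := hP).
    apply (is_RInt_derive (V := R_CompleteNormedModule) P).
    - intros t _; unfold P, q; auto_derive.
      + repeat split; try apply hx; try apply hdx; eexists; apply hFd.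
      (* Replacing [e t] by the left side of the equation turns [P' = q] into an algebraic
         identity. *)
      + change (Derive (fun x0 => int_from0 f x0)) with (Derive (int_from0 f)).
        rewrite (is_derive_unique _ _ _ (hFd (x t))), <- (heq t).
        change (Derive (fun x0 => Derive x x0) t) with (Derive_n x 2 t).
        change (Derive (fun x0 => x x0)) with (Derive x).
        unfold Rminus.
        field; exact hn0.
    - intros t _; unfold q.
      destruct (htr t) as [hcos hsin].
      apply (continuous_minus (V := R_NormedModule)).
      + apply (continuous_mult (fun s => e s - (g (x s) - d)) _); [|exact hcos].
        apply (continuous_minus (V := R_NormedModule)); [apply he|].
        apply (continuous_minus (V := R_NormedModule)); [apply hgx | apply continuous_const].
      + apply (continuous_mult (fun s => INR n * (int_from0 f (x s) - c)) _); [|exact hsin].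
        apply (continuous_mult (fun _ => INR n) (fun s => int_from0 f (x s) - c));
          [apply continuous_const|].
        apply (continuous_minus (V := R_NormedModule)); [apply hFx | apply continuous_const]. }
  apply (is_RInt_ext (fun t => minus (e t * cos (INR n * t - p)) (q t))).
  { intros t _; unfold q, minus, plus, opp; simpl; ring. }
  replace (fourier_cos e n * cos p + fourier_sin e n * sin p)
    with (minus (fourier_cos e n * cos p + fourier_sin e n * sin p) 0)
    by (unfold minus, plus, opp; simpl; ring).
  apply (is_RInt_minus (V := R_NormedModule)); [apply fourier_rotate; exact he | exact hq].
Qed.

(** * The amplitude estimate *)

Lemma Rmult_le_Rabs_bound (a b M : R) : Rabs a <= M -> a * b <= M * Rabs b.
Proof.
  intros h; apply Rle_trans with (1 := Rle_abs _).
  rewrite Rabs_mult; apply Rmult_le_compat_r; [apply Rabs_pos | exact h].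
Qed.

Theorem proposition1 (n : nat) (e f g : R -> R) (Fm Fp gm gp : R)
  (hn : (1 <= n)%nat)
  (he : forall t : R, continuous e t)
  (heper : periodic (2 * PI) e)
  (hf : forall z : R, continuous f z)
  (hg : forall z : R, continuous g z)
  (hFm : is_lim (int_from0 f) m_infty (Finite Fm))
  (hFp : is_lim (int_from0 f) p_infty (Finite Fp))
  (hgm : is_lim g m_infty (Finite gm))
  (hgp : is_lim g p_infty (Finite gp))
  (hF : forall x : R, Fm < int_from0 f x < Fp)
  (hgb : forall x : R, gm < g x < gp)
  (hsol : exists x : R -> R, is_solution n e f g x /\ periodic (2 * PI) x) :
  sqrt (fourier_cos e n ^ 2 + fourier_sin e n ^ 2)
    < 2 * INR n * (Fp - Fm) + 2 * (gp - gm).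
Proof.
  destruct hsol as [x [hx hper]].
  assert (hn0 : 0 < INR n) by (apply lt_0_INR; lia).
  assert (hpi : 0 <= 2 * PI) by (pose proof PI_RGT_0; lra).
  assert (hxc : forall t, continuous x t)
    by (intros t; apply (@ex_derive_continuous R_AbsRing R_NormedModule), (proj1 (proj1 hx))).
  destruct (polar_form (fourier_cos e n) (fourier_sin e n)) as [p hp].
  rewrite <- hp.
  destruct (bounded_strictly_inside (fun t => int_from0 f (x t)) 0 (2 * PI) Fm Fp hpi)
    as [MF [hMF hMFb]].
  { intros t; apply (continuous_comp x (int_from0 f)); [apply hxc|].
    apply (@ex_derive_continuous R_AbsRing R_NormedModule); eexists.
    apply is_derive_int_from0; exact hf. }
  { intros t; apply hF. }
  destruct (bounded_strictly_inside (fun t => g (x t)) 0 (2 * PI) gm gp hpi)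
    as [MG [hMG hMGb]].
  { intros t; apply (continuous_comp x g); [apply hxc | apply hg]. }
  { intros t; apply hgb. }
  (* Each 4 is the integral of a rectified sine; [MG] and [MF] lie strictly below the half-widths of
     the ranges, which gives the strict part. *)
  apply Rle_lt_trans with (MG * 4 + INR n * MF * 4); [|nra].
  (* [|cos (n t - p)|] is written as a sine with phase [p - PI / 2], so one lemma evaluates both
     integrals. The recentring constants are the midpoints. *)
  refine (is_RInt_le _
    (fun t => MG * Rabs (sin (INR n * t - (p - PI / 2)))
              + INR n * MF * Rabs (sin (INR n * t - p))) _ _ _ _ hpi
    (solution_identity n e f g x p ((Fm + Fp) / 2) ((gm + gp) / 2)
       hn he hf hg hx hper) _ _).
  - apply (is_RInt_plus (V := R_NormedModule));
      apply (is_RInt_scal (V := R_NormedModule)); apply is_RInt_abs_sin_affine; exact hn.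
  - intros t ht.
    replace (INR n * t - (p - PI / 2)) with (PI / 2 + (INR n * t - p)) by ring.
    rewrite <- cos_sin.
    apply Rplus_le_compat; apply Rmult_le_Rabs_bound.
    + apply hMGb; lra.
    + rewrite Rabs_mult, (Rabs_pos_eq (INR n)) by lra.
      apply Rmult_le_compat_l; [lra | apply hMFb; lra].
Qed.
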